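(* The competitive ratio of the Move-All-Equally algorithm for $r$-uniform Online Min-Sum Set Cover against the static optimum is $\Omega(r^2)$; that is, there is an absolute constant $c>0$ such that for every $r$ there are universe sizes $n$ for which the competitive ratio of Move-All-Equally is at least $c\,r^2$.
   Context: Let $U$ be a set of $n$ elements; a permutation $\pi$ of $U$ gives each element $e$ a position $\pi[e]\in\{1,\dots,n\}$, and for nonempty $S\subseteq U$, $\pi(S)=\min_{e\in S}\pi[e]$. $d_{KT}(\pi,\sigma)$ is the number of pairs of elements ordered differently by $\pi,\sigma$. In $r$-uniform Online Min-Sum Set Cover, starting from an initial permutation $\pi_0$, request sets $S_1,\dots,S_m\subseteq U$ with $|S_t|=r$ arrive online; on arrival of $S_t$ an algorithm holding $\pi_{t-1}$ pays $\pi_{t-1}(S_t)$ and then moves to $\pi_t$ paying $d_{KT}(\pi_{t-1},\pi_t)$. The static optimum is $\mathrm{OPT}=\min_\pi\sum_t\pi(S_t)$. An algorithm is $c$-competitive if its total cost is at most $c\cdot\mathrm{OPT}+\alpha$ for all initial permutations and sequences, for some $\alpha$ independent of the sequence (possibly depending on $n,r$); the competitive ratio is the infimum of such $c$. Move-All-Equally: given current permutation $\pi$ and request $S$, let $k=\pi(S)$; the new permutation $\pi'$ places each $e\in S$ at position $\pi'[e]=\pi[e]-(k-1)$, and the elements of $U\setminus S$ fill the remaining positions in the same relative order as in $\pi$. *)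

(* Defs.v *)
From HB Require Import structures.
From mathcomp Require Import all_boot all_order all_algebra all_fingroup.

Set Implicit Arguments.
Unset Strict Implicit.
Unset Printing Implicit Defensive.

Import Order.TTheory GRing.Theory Num.Theory.

(** The universe is ['I_n].  A permutation [pi : 'S_n] sends an element to its
    0-based position, so that [pos pi e] ranges over 1, ..., n. *)
Definition pos (n : nat) (pi : 'S_n) (e : 'I_n) : nat := (pi e).+1.

(** The default value [n] bounds every position, so it only matters when [S]
    is empty. *)
Definition min_pos (n : nat) (pi : 'S_n) (S : {set 'I_n}) : nat :=
  \big[minn/n]_(e in S) pos pi e.

(** Each unordered pair on which [pi] and [sigma] disagree contributes exactly
    one ordered pair to this set. *)
Definition kendall_tau (n : nat) (pi sigma : 'S_n) : nat :=
  #|[set p : 'I_n * 'I_n |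
      (pos pi p.1 < pos pi p.2) && (pos sigma p.2 < pos sigma p.1)]|.

Definition static_cost (n : nat) (pi : 'S_n) (reqs : seq {set 'I_n}) : nat :=
  \sum_(S <- reqs) min_pos pi S.

Definition opt (n : nat) (reqs : seq {set 'I_n}) : nat :=
  static_cost [arg min_(pi < 1%g : 'S_n) static_cost pi reqs] reqs.

(** [step pi A] is the permutation to which the algorithm moves when it holds
    [pi] and serves [A]. *)
Fixpoint total_cost (n : nat) (step : 'S_n -> {set 'I_n} -> 'S_n)
    (pi : 'S_n) (reqs : seq {set 'I_n}) : nat :=
  if reqs is A :: reqs' then
    min_pos pi A + kendall_tau pi (step pi A) + total_cost step (step pi A) reqs'
  else 0.

Definition is_mae_step (n : nat) (pi : 'S_n) (S : {set 'I_n}) (pi' : 'S_n)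
    : bool :=
  [forall e in S, pos pi' e == pos pi e - (min_pos pi S - 1)] &&
  [forall e in ~: S, forall e' in ~: S,
     (pos pi' e < pos pi' e') == (pos pi e < pos pi e')].

Section MoveAllEqually.
Variables (n : nat) (pi : 'S_n) (S : {set 'I_n}).

Let m := min_pos pi S - 1.

Let min_posP e : e \in S -> m <= pi e.
Proof.
move=> eS; rewrite /m leq_subLR add1n /min_pos.
have := mem_index_enum e; elim: (index_enum _) => //= x s IHs.
rewrite inE big_cons => /predU1P[<-|/IHs le_s]; first by rewrite eS geq_minl.
by case: ifP => // _; apply: leq_trans (geq_minr _ _) le_s.
Qed.

Let shift (e : 'I_n) : 'I_n :=
  Ordinal (leq_ltn_trans (leq_subr m (pi e)) (ltn_ord (pi e))).

Let shift_inj : {in S &, injective shift}.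
Proof.
move=> e e' eS e'S /(congr1 val) /= eq_shift.
apply/(@perm_inj _ pi)/val_inj => /=.
by rewrite -(subnK (min_posP eS)) eq_shift subnK // min_posP.
Qed.

Let src : seq 'I_n := enum (~: (pi @: S)).
Let tgt : seq 'I_n := enum (~: (shift @: S)).

Let sorted_enum_ord (A : {set 'I_n}) :
  sorted (fun i j : 'I_n => i < j) (enum A).
Proof.
rewrite {1}/enum_mem -enumT; apply: sorted_filter.
  by move=> i j k; apply: ltn_trans.
have := iota_ltn_sorted 0 n; rewrite -val_enum_ord sorted_map.
by [].
Qed.

Let size_tgt : size tgt = size src.
Proof.
rewrite /tgt /src -!cardE [LHS]cardsCs [RHS]cardsCs !setCK.
by rewrite (card_in_imset shift_inj) card_imset //; apply: perm_inj.
Qed.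

Let mem_src e : e \notin S -> pi e \in src.
Proof.
by move=> eS; rewrite mem_enum inE (mem_imset _ _ (@perm_inj _ pi)).
Qed.

Let fill (e : 'I_n) : 'I_n := nth e tgt (index (pi e) src).

Let fill_lt e e' : e \notin S -> e' \notin S -> pi e < pi e' ->
  fill e < fill e'.
Proof.
move=> eS e'S lt_ee'.
have tr : transitive (fun i j : 'I_n => i < j).
  by move=> i j k; apply: ltn_trans.
have ie : index (pi e) src < size tgt by rewrite size_tgt index_mem mem_src.
have ie' : index (pi e') src < size tgt by rewrite size_tgt index_mem mem_src.
have lt_ix : index (pi e) src < index (pi e') src.
  case: (ltngtP (index (pi e) src) (index (pi e') src)) => // [gt|eq].
    have i1 : index (pi e) src < size src by rewrite index_mem mem_src.
    have i2 : index (pi e') src < size src by rewrite index_mem mem_src.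
    have := sorted_ltn_nth tr e (sorted_enum_ord _) _ _ i2 i1 gt.
    rewrite !nth_index ?mem_src // => lt_e'e.
    by have := ltn_trans lt_ee' lt_e'e; rewrite ltnn.
  have E := congr1 (nth e src) eq.
  by rewrite !nth_index ?mem_src // in E; rewrite E ltnn in lt_ee'.
rewrite /fill (set_nth_default e e' ie').
exact: (sorted_ltn_nth tr e (sorted_enum_ord _) _ _ ie ie' lt_ix).
Qed.

Let fill_mono e e' : e \notin S -> e' \notin S ->
  (fill e < fill e') = (pi e < pi e').
Proof.
move=> eS e'S; case: (ltngtP (pi e) (pi e')) => [|gt|/val_inj/perm_inj->].
- exact: fill_lt.
- by apply/negbTE; rewrite -leqNgt ltnW // fill_lt.
- exact: ltnn.
Qed.

Let fill_notin e : e \notin S -> fill e \notin shift @: S.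
Proof.
move=> eS; have : fill e \in tgt by rewrite mem_nth // size_tgt index_mem mem_src.
by rewrite mem_enum inE.
Qed.

Let mae_fun (e : 'I_n) : 'I_n := if e \in S then shift e else fill e.

Let mae_fun_inj : injective mae_fun.
Proof.
move=> e e'; rewrite /mae_fun.
case: ifPn => eS; case: ifPn => e'S eq_ee'.
- exact: shift_inj.
- by have := fill_notin e'S; rewrite -eq_ee' imset_f.
- by have := fill_notin eS; rewrite eq_ee' imset_f.
- apply/(@perm_inj _ pi)/val_inj.
  have := fill_mono eS e'S; have := fill_mono e'S eS.
  by rewrite eq_ee' ltnn; case: ltngtP.
Qed.

Lemma mae_step_exists : exists pi' : 'S_n, is_mae_step pi S pi'.
Proof.
exists (perm mae_fun_inj); apply/andP; split.
  apply/forall_inP => e eS; rewrite /pos permE /mae_fun eS /=.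
  by rewrite -/m subSn // min_posP.
apply/forall_inP => e; rewrite inE => eS.
apply/forall_inP => e'; rewrite inE => e'S.
by rewrite /pos !permE /mae_fun (negbTE eS) (negbTE e'S) !ltnS fill_mono.
Qed.

Lemma mae_step_unique (pi1 pi2 : 'S_n) :
  is_mae_step pi S pi1 -> is_mae_step pi S pi2 -> pi1 = pi2.
Proof.
case/andP=> /forall_inP in1 /forall_inP out1.
case/andP=> /forall_inP in2 /forall_inP out2.
have eqS e : e \in S -> pi1 e = pi2 e.
  move=> eS; apply/val_inj/succn_inj.
  exact: etrans (eqP (in1 e eS)) (esym (eqP (in2 e eS))).
have outS e e' : e \notin S -> e' \notin S ->
    (pi1 e < pi1 e') = (pi2 e < pi2 e').
  rewrite -!in_setC => eS e'S.
  have /forall_inP/(_ e' e'S)/eqP h1 := out1 e eS.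
  have /forall_inP/(_ e' e'S)/eqP h2 := out2 e eS.
  by rewrite /pos !ltnS in h1 h2; rewrite h1 h2.
apply/permP => e; have [k] := ubnP (pi1 e).
elim: k e => // k IHk e; rewrite ltnS => le_k.
have [/eqS //|eS] := boolP (e \in S).
have lt_eq e' : pi1 e' < pi1 e -> pi1 e' = pi2 e'.
  by move=> lt_e'e; apply: IHk; apply: leq_trans le_k.
apply: val_inj; case: (ltngtP (pi1 e) (pi2 e)) => // [lt12|lt21].
- pose e2 := (pi2^-1)%g (pi1 e).
  have e2E : pi2 e2 = pi1 e by rewrite permKV.
  have ne : e2 != e by apply/eqP => E; rewrite -e2E E ltnn in lt12.
  have e2S : e2 \notin S.
    by apply: contra ne => /eqS; rewrite e2E => /perm_inj ->.
  have := outS _ _ e2S eS; rewrite e2E lt12 => /lt_eq.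
  by rewrite e2E => /perm_inj E; rewrite E eqxx in ne.
- pose e3 := (pi1^-1)%g (pi2 e).
  have e3E : pi1 e3 = pi2 e by rewrite permKV.
  have := lt_eq e3; rewrite e3E => /(_ lt21)/perm_inj E.
  by rewrite -e3E -E ltnn in lt21.
Qed.

Definition move_all_equally : 'S_n := xchoose mae_step_exists.

Lemma move_all_equallyP : is_mae_step pi S move_all_equally.
Proof. exact: xchooseP. Qed.

End MoveAllEqually.

From mathcomp Require Import all_classical all_reals ereal.

Local Open Scope ring_scope.
Local Open Scope classical_set_scope.

Definition competitive (R : realType) (n r : nat)
    (step : 'S_n -> {set 'I_n} -> 'S_n) (c : R) : Prop :=
  exists alpha : R, forall (pi0 : 'S_n) (reqs : seq {set 'I_n}),
    all (fun S : {set 'I_n} => #|S| == r) reqs ->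
    (total_cost step pi0 reqs)%:R <= c * (opt reqs)%:R + alpha.

Definition competitive_ratio (R : realType) (n r : nat)
    (step : 'S_n -> {set 'I_n} -> 'S_n) : \bar R :=
  ereal_inf [set c%:E | c in [set c : R | competitive r step c]].

(* Main.v *)
Require Import Defs.
From mathcomp Require Import all_boot all_order all_algebra all_fingroup.
From mathcomp Require Import all_classical all_reals ereal.
From mathcomp Require Import zify lra.

Import Order.TTheory GRing.Theory Num.Theory.
Local Open Scope ring_scope.

(** Let [n = 2r] and alternate between requesting the back half and the front
    half of the initial list.  Move-All-Equally always finds the requested half
    at the back and swaps the two halves, paying at least [r ^ 2] in movement
    for each request.  A static list whose first two places hold one element of
    each half pays at most 3 for two consecutive requests. *)

Section MinPos.
Set Implicit Arguments.
Unset Strict Implicit.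
Local Open Scope nat_scope.
Variables (n : nat) (pi : 'S_n) (S : {set 'I_n}).

Lemma min_pos_le (e : 'I_n) : e \in S -> min_pos pi S <= pos pi e.
Proof.
move=> eS; rewrite /min_pos.
have := mem_index_enum e; elim: (index_enum _) => //= x s IHs.
rewrite inE big_cons => /predU1P[<-|/IHs le_s]; first by rewrite eS geq_minl.
by case: ifP => // _; apply: leq_trans (geq_minr _ _) le_s.
Qed.

(** The hypothesis [k <= n] covers the default value [n] from which the minimum in [min_pos]
    starts. *)
Lemma min_pos_ge (k : nat) :
  k <= n -> (forall e, e \in S -> k <= pos pi e) -> k <= min_pos pi S.
Proof.
move=> le_kn le_kS; rewrite /min_pos.
by apply: (big_ind (fun m => k <= m)) => // x y; rewrite leq_min => -> ->.
Qed.

Lemma min_pos_eq (e : 'I_n) :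
  e \in S -> (forall e', e' \in S -> pi e <= pi e') -> min_pos pi S = pos pi e.
Proof.
move=> eS le_e; apply/eqP; rewrite eqn_leq min_pos_le //=.
by apply: min_pos_ge => //; apply: ltn_ord.
Qed.

Lemma is_mae_step_eq (pi' : 'S_n) :
  is_mae_step pi S pi' -> move_all_equally pi S = pi'.
Proof. exact/mae_step_unique/move_all_equallyP. Qed.

Lemma opt_le (reqs : seq {set 'I_n}) : opt reqs <= static_cost pi reqs.
Proof. by rewrite /opt; case: arg_minnP => // sigma _; apply. Qed.

End MinPos.

Section TwoHalves.
Local Open Scope nat_scope.
Variable s : nat.
Local Notation r := s.+1.
Local Notation I := 'I_(r + r).

Definition front : {set I} := [set e : I | e < r].
Definition back : {set I} := [set e : I | r <= e].

Lemma card_front : #|front| = r.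
Proof.
have -> : front = [set lshift r i | i : 'I_r].
  apply/setP=> e; rewrite inE; apply/idP/imsetP => [lt_er|[i _ ->]];
    last exact: (ltn_ord i).
  by exists (Ordinal lt_er) => //; apply: val_inj.
by rewrite card_imset ?card_ord //; apply: lshift_inj.
Qed.

Lemma card_back : #|back| = r.
Proof.
have -> : back = ~: front by apply/setP=> e; rewrite !inE -leqNgt.
by rewrite cardsCs finset.setCK card_ord card_front addnK.
Qed.

(** Since [r] is a successor, [I] is convertible to ['I_(s + r).+1], the form that [inord]
    requires. *)
Definition swap_fun (e : I) : I :=
  @inord (s + r) (if e < r then e + r else e - r).

Lemma val_swap_fun e : swap_fun e = (if e < r then e + r else e - r) :> nat.
Proof.
by rewrite (@inordK (s + r)) //; have := ltn_ord e; case: ifP => ? ?; lia.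
Qed.

Lemma swap_funK : involutive swap_fun.
Proof.
move=> e; apply: val_inj; have := ltn_ord e.
by rewrite /= !val_swap_fun; case: (ltnP e r) => ?; case: ifP => ?; lia.
Qed.

Definition swap : 'S_(r + r) := perm (inv_inj swap_funK).

Lemma val_swap e : swap e = (if e < r then e + r else e - r) :> nat.
Proof. by rewrite permE val_swap_fun. Qed.

(** Under the identity the first element of [back] has position [r + 1], so [back] moves forward by
    exactly [r] and [front] fills the last [r] places in order. *)
Lemma mae_back : move_all_equally 1%g back = swap.
Proof.
have rP : r < r + r by lia.
apply: is_mae_step_eq; apply/andP; split.
  apply/forall_inP => e; rewrite inE => le_re.
  rewrite (@min_pos_eq _ _ _ (Ordinal rP)) ?inE //.
    by rewrite /pos val_swap !perm1 /=; case: ifP => ?; lia.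
  by move=> e'; rewrite inE !perm1.
apply/forall_inP => e; rewrite !inE -ltnNge => lt_er.
apply/forall_inP => e'; rewrite !inE -ltnNge => lt_e'r.
by rewrite /pos !val_swap !perm1 lt_er lt_e'r; lia.
Qed.

Lemma mae_front : move_all_equally swap front = 1%g.
Proof.
have rP : 0 < r + r by [].
apply: is_mae_step_eq; apply/andP; split.
  apply/forall_inP => e; rewrite inE => lt_er.
  (* Under [swap], element 0 leads [front] at position [r + 1], so the shift is again [r]. *)
  rewrite (@min_pos_eq _ _ _ (Ordinal rP)) ?inE //.
    by rewrite /pos !val_swap !perm1 /= lt_er; lia.
  by move=> e'; rewrite inE !val_swap /= => ->; lia.
apply/forall_inP => e; rewrite !inE -leqNgt => le_re.
apply/forall_inP => e'; rewrite !inE -leqNgt => le_re'.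
by rewrite /pos !val_swap !perm1 !(ltnNge _ r) le_re le_re' /=; lia.
Qed.

(** Every pair in [front] x [back] is inverted by [swap]. *)
Lemma kendall_tau_swap : r ^ 2 <= kendall_tau 1%g swap.
Proof.
have -> : r ^ 2 = #|finset.setX front back|
  by rewrite cardsX card_back card_front mulnn.
apply/subset_leq_card/fintype.subsetP.
case=> e e'; rewrite !inE /= => /andP[lt_er le_re'].
rewrite /pos !val_swap !perm1 lt_er (ltnNge _ r) le_re' /=.
by have := ltn_ord e'; lia.
Qed.

Lemma kendall_tau_swapV : r ^ 2 <= kendall_tau swap 1%g.
Proof.
have -> : r ^ 2 = #|finset.setX back front|
  by rewrite cardsX card_back card_front mulnn.
apply/subset_leq_card/fintype.subsetP.
case=> e e'; rewrite !inE /= => /andP[le_re lt_e'r].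
rewrite /pos !val_swap !perm1 lt_e'r (ltnNge _ r) le_re /=.
by have := ltn_ord e; lia.
Qed.

Definition alternate (m : nat) : seq {set I} :=
  flatten (nseq m [:: back; front]).

Lemma alternateS m : alternate m.+1 = [:: back, front & alternate m].
Proof. by []. Qed.

Lemma alternate_uniform m : all (fun S : {set I} => #|S| == r) (alternate m).
Proof. by elim: m => //= m ->; rewrite card_back card_front eqxx. Qed.

(** Two requests bring the list back to the identity, so the induction restarts from the same
    permutation; access costs are dropped. *)
Lemma total_cost_alternate m :
  m * (2 * r ^ 2) <= total_cost (@move_all_equally _) 1%g (alternate m).
Proof.
elim: m => // m IHm; rewrite alternateS /= mae_back mae_front.
by have := kendall_tau_swap; have := kendall_tau_swapV; lia.
Qed.

Lemma opt_alternate m : opt (alternate m) <= m * 3.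
Proof.
have lt0 : 0 < r + r by [].
have lt1 : 1 < r + r by lia.
have ltr : r < r + r by lia.
pose e0 : I := Ordinal lt0; pose e1 : I := Ordinal lt1.
pose er : I := Ordinal ltr.
(* This puts [e0] from [front] first and [er] from [back] second; for [r = 1] it is the identity,
   which already does so. *)
pose tau : 'S_(r + r) := tperm e1 er.
have le_front : min_pos tau front <= 1.
  have e0F : e0 \in front by rewrite inE.
  by apply: leq_trans (min_pos_le _ e0F) _; rewrite /pos tpermD.
have le_back : min_pos tau back <= 2.
  have erB : er \in back by rewrite inE.
  by apply: leq_trans (min_pos_le _ erB) _; rewrite /pos tpermR.
apply: leq_trans (opt_le tau _) _.
rewrite /static_cost; elim: m => [|m IHm]; first by rewrite big_nil.
by rewrite alternateS !big_cons; lia.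
Qed.

End TwoHalves.

Theorem theorem3 (R : realType) :
  exists c : R, 0 < c /\
    forall r : nat, (0 < r)%N ->
      exists n : nat,
        ((c * r%:R ^+ 2)%:E <=
           competitive_ratio R r (@move_all_equally n))%E.
Proof.
(* The two bounds give a ratio of [2 * r ^ 2 / 3] per round; taking 1/2 below 2/3 leaves slack to
   absorb [alpha]. *)
exists (1 / 2); split; first by lra.
case=> // s _; exists (s.+1 + s.+1)%N.
apply: le_ereal_inf_tmp => _ [c [alpha compc] <-]; rewrite lee_fin leNgt.
apply/negP => lt_c.
(* With [c < q / 2] and [q = r ^ 2], the competitive bound is at most [3/2 * q * m + alpha], while
   the cost is at least [2 * q * m]. The gap [q * m / 2] is at least [m / 2], hence exceeds
   [alpha]. *)
have [m lt_m] : exists m : nat, 2 * alpha < m%:R.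
  by exists (Num.truncn (2 * alpha)).+1; exact: truncnS_gt.
have := compc 1%g _ (alternate_uniform s m).
apply/negP; rewrite -ltNge.
have := total_cost_alternate s m; have := opt_alternate s m.
set T := total_cost _ _ _; set O := opt _; rewrite -!(ler_nat R) !natrM -expr2.
move=> le_O; apply: lt_le_trans.
set q : R := s.+1%:R ^+ 2 in lt_c *.
have q1 : 1 <= q by rewrite expr_ge1 // ?ler1n.
have O0 : 0 <= O%:R :> R by [].
have m0 : 0 <= m%:R :> R by [].
have le1 : c * O%:R <= 1 / 2 * q * O%:R by rewrite ler_wpM2r // ltW.
have le2 : q * O%:R <= q * (m%:R * 3) by rewrite ler_wpM2l //; lra.
have le3 : m%:R * 1 <= m%:R * q by rewrite ler_wpM2l.
lra.
Qed.
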